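(* Consider the half-orthant model on $\mathbb{Z}^d$, $d\ge2$, and let $p>p_1$, with $p_1$ and the function $\gamma:\mathbb{R}^d\to\mathbb{R}$ (depending on $p$) as described in the context. For $\delta>0$ let $C_\delta=\{z\in\mathbb{R}^d:\gamma(z)\le-\delta\}$. Then for every $\delta>0$ and every $R<\infty$, the following holds $\mathbb{P}_p$-a.s. for all sufficiently large (random) $n$: $$O_R\cap C_\delta\cap\tfrac1n\mathbb{Z}^d\subset\tfrac1n\mathcal{C}_o .$$
   Context: Half-orthant model: let $e_1,\dots,e_d$ be the canonical basis vectors, $\mathcal{E}_+=\{e_1,\dots,e_d\}$, $\mathcal{E}_-=\{-e_1,\dots,-e_d\}$, $\mathcal{E}=\mathcal{E}_+\cup\mathcal{E}_-$. For $p\in[0,1]$, the random sets $(\mathcal{G}_x)_{x\in\mathbb{Z}^d}$ are i.i.d. with $\mathcal{G}_x=\mathcal{E}_+$ with probability $p$ and $\mathcal{G}_x=\mathcal{E}$ with probability $1-p$; their law is $\mathbb{P}_p$. From each site $x$ there are arrows to $x+e$, $e\in\mathcal{G}_x$. $\mathcal{C}_o\subset\mathbb{Z}^d$ is the set of sites that can be reached from the origin $o$ by following arrows (including $o$). Notation: $O_r=\{x\in\mathbb{R}^d:\|x\|_\infty\le r\}$; $sH=\{sx:x\in H\}$ for $H\subset\mathbb{R}^d$; $\boldsymbol{1}=\sum_{i=1}^d e_i$; $\beta_n(u)=\inf\{k\in\mathbb{Z}:k\boldsymbol{1}+nu\in\mathcal{C}_o\}$; the positive orthant is the set of points with all coordinates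 nonnegative. The constant $p_1=p_1(d)<1$ and the function $\gamma$: by the shape theorem for this model, there is a $p_1<1$ such that for all $p>p_1$: (a) for each $u\in\mathbb{Z}^d$ there is a deterministic $\gamma(u)$ with $\beta_n(u)/n\to\gamma(u)$ $\mathbb{P}_p$-a.s.; (b) for $r\in\mathbb{Z}_+$, $u,w\in\mathbb{Z}^d$: $\gamma(u+w)\le\gamma(u)+\gamma(w)$, $\gamma(ru)=r\gamma(u)$, $\gamma(u+r\boldsymbol{1})=\gamma(u)-r$, $\gamma$ is symmetric under permutation of coordinates, $\gamma(u)\ge0$ if $u\cdot\boldsymbol{1}\le0$, $\gamma(u)\le0$ if $u$ lies in the positive orthant; (c) $\gamma$ extends to a Lipschitz map $\mathbb{R}^d\to\mathbb{R}$ with the properties in (b) for $r\in[0,\infty)$, $u,w\in\mathbb{R}^d$; (d) $C=\{z\in\mathbb{R}^d:\gamma(z)\le0\}$ is a closed convex cone, symmetric under permutations of coordinates, containing the positive orthant and contained in $\{z:z\cdot\boldsymbol{1}\ge0\}$; (e) for every $\epsilon>0$ and $r\in[0,\infty)$, $\mathbb{P}_p$-a.s. for all sufficiently large (random) $n$, $O_r\cap\frac1n\mathcal{C}_o\subset O_\epsilon+C$ and $O_r\cap C\subset O_\epsilon+\frac1n\mathcal{C}_o$. Here $p_1$ denotes such a constant and $\gamma$ the resulting (extended) function. *)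

(* Defs.v *)
(* Points of Z^d are row vectors 'rV[int]_d and points of R^d row vectors
   'rV[R]_d, whose library norm is the sup norm. *)
From mathcomp Require Export all_boot all_order all_algebra perm.
From mathcomp Require Export all_classical all_reals all_analysis.

Set Implicit Arguments.
Unset Strict Implicit.
Unset Printing Implicit Defensive.

Export Order.TTheory GRing.Theory Num.Theory.
Export numFieldNormedType.Exports.

Open Scope classical_set_scope.
Open Scope ring_scope.

Definition E_plus (d : nat) : set 'rV[int]_d :=
  [set delta_mx 0 i | i in [set: 'I_d]].
Definition E_minus (d : nat) : set 'rV[int]_d :=
  [set - delta_mx 0 i | i in [set: 'I_d]].
Definition E_full (d : nat) : set 'rV[int]_d := @E_plus d `|` @E_minus d.

(* Mutual independence of a family of random elements of [S], where [S] carries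
   the discrete sigma-algebra. *)
Definition mutually_independent (R : realType) (disp : measure_display)
    (Omega : measurableType disp) (P : probability Omega R)
    (I : choiceType) (S : Type) (X : I -> Omega -> S) : Prop :=
  forall (s : seq I) (B : I -> set S), uniq s ->
    P (\bigcap_(i in [set` s]) (X i @^-1` B i)) =
    (\prod_(i <- s) P (X i @^-1` B i))%E.

(* [G x] is the random set of steps available at site [x].  The laws force
   [G x] to be E_plus or E_full only almost surely, so the values of [G x] on a
   null set are left arbitrary. *)
Record half_orthant_model (R : realType) (d : nat) (p : R)
    (disp : measure_display) (Omega : measurableType disp)
    (P : probability Omega R) (G : 'rV[int]_d -> Omega -> set 'rV[int]_d)
    : Prop := HalfOrthantModel {
  hom_measurable : forall (x : 'rV[int]_d) (B : set (set 'rV[int]_d)),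
    measurable (G x @^-1` B);
  hom_plus : forall x : 'rV[int]_d,
    P [set w | G x w = @E_plus d] = p%:E;
  hom_full : forall x : 'rV[int]_d,
    P [set w | G x w = @E_full d] = (1 - p)%:E;
  hom_indep : mutually_independent P G
}.

(* The set C_o of sites reachable from the origin in the configuration [g]. *)
Inductive reachable (d : nat) (g : 'rV[int]_d -> set 'rV[int]_d) :
    'rV[int]_d -> Prop :=
| reachable_origin : reachable g 0
| reachable_step (x e : 'rV[int]_d) :
    reachable g x -> g x e -> reachable g (x + e).

Definition to_real (R : realType) (d : nat) (x : 'rV[int]_d) : 'rV[R]_d :=
  map_mx intr x.

(* [rescale n H] is n^-1 H as a subset of R^d; the junk value at n = 0 is
   harmless since only large n are ever considered. *)
Definition rescale (R : realType) (d : nat) (n : nat) (H : set 'rV[int]_d) :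
    set 'rV[R]_d :=
  [set n%:R^-1 *: @to_real R d x | x in H].

Definition box (R : realType) (d : nat) (r : R) : set 'rV[R]_d :=
  [set x | `|x| <= r].

Definition set_sum (R : realType) (d : nat) (A B : set 'rV[R]_d) :
    set 'rV[R]_d :=
  [set a + b | a in A & b in B].

(* Extended-real valued: the infimum may be -oo. *)
Definition beta (R : realType) (d : nat) (Co : set 'rV[int]_d) (n : nat)
    (u : 'rV[int]_d) : \bar R :=
  ereal_inf [set (k%:~R : R)%:E | k in
    [set k : int | Co (k *: const_mx 1 + u *+ n)]].

(* The algebraic properties of the limit shape, for vectors in [S] and scalars
   in [T]: used with (Z^d, Z_+) and with (R^d, [0, oo)). *)
Record shape_rules (R : realType) (d : nat) (S : set 'rV[R]_d) (T : set R)
    (gamma : 'rV[R]_d -> R) : Prop := ShapeRules {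
  shape_subadd : forall u w, S u -> S w -> gamma (u + w) <= gamma u + gamma w;
  shape_homog : forall r u, T r -> S u -> gamma (r *: u) = r * gamma u;
  shape_shift : forall r u, T r -> S u ->
    gamma (u + r *: const_mx 1) = gamma u - r;
  shape_perm : forall (s : 'S_d) u, S u -> gamma (col_perm s u) = gamma u;
  shape_ge0 : forall u, S u -> \sum_i u ord0 i <= 0 -> 0 <= gamma u;
  shape_le0 : forall u, S u -> (forall i, 0 <= u ord0 i) -> gamma u <= 0
}.

Definition sublevel (R : realType) (d : nat) (gamma : 'rV[R]_d -> R) (a : R) :
    set 'rV[R]_d :=
  [set z | gamma z <= a].

Record shape_cone (R : realType) (d : nat) (C : set 'rV[R]_d) : Prop :=
  ShapeCone {
  cone_closed : closed C;
  cone_convex : convex_set (C : set (convex_lmodType 'rV[R]_d));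
  cone_scale : forall (r : R) z, 0 <= r -> C z -> C (r *: z);
  cone_perm : forall (s : 'S_d) z, C z -> C (col_perm s z);
  cone_orthant : [set z : 'rV[R]_d | forall i, 0 <= z ord0 i] `<=` C;
  cone_halfspace : C `<=` [set z : 'rV[R]_d | 0 <= \sum_i z ord0 i]
}.

(* [gamma] is the (extended) function produced by the shape theorem for the
   realisation [G] of the model. *)
Record shape_function (R : realType) (d : nat)
    (disp : measure_display) (Omega : measurableType disp)
    (P : probability Omega R) (G : 'rV[int]_d -> Omega -> set 'rV[int]_d)
    (gamma : 'rV[R]_d -> R) : Prop := ShapeFunction {
  sf_limit : forall u : 'rV[int]_d,
    {ae P, forall w : Omega,
      ((n%:R^-1)%:E * beta R (reachable (G ^~ w)) n u)%E @[n --> \oo]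
        --> (gamma (@to_real R d u))%:E};
  sf_lattice : shape_rules (range (@to_real R d)) (range (fun m => m%:R)) gamma;
  sf_lipschitz : lipschitz (gamma : 'rV[R]_d -> R^o);
  sf_real : shape_rules [set: 'rV[R]_d] [set r | 0 <= r] gamma;
  sf_cone : shape_cone (sublevel gamma 0);
  sf_upper : forall eps r : R, 0 < eps -> 0 <= r ->
    {ae P, forall w : Omega, \forall n \near \oo,
      box r `&` rescale n (reachable (G ^~ w))
        `<=` set_sum (box eps) (sublevel gamma 0)};
  sf_lower : forall eps r : R, 0 < eps -> 0 <= r ->
    {ae P, forall w : Omega, \forall n \near \oo,
      box r `&` sublevel gamma 0
        `<=` set_sum (box eps) (rescale n (reachable (G ^~ w)))}
}.

(* [p1] is a constant for which the conclusion of the shape theorem holds.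
   [gamma] may depend on [p] but not on the realisation of the model. *)
Definition shape_constant (R : realType) (d : nat) (p1 : R) : Prop :=
  p1 < 1 /\
  forall p : R, 0 <= p <= 1 -> p1 < p ->
    exists gamma : 'rV[R]_d -> R,
      forall (disp : measure_display) (Omega : measurableType disp)
        (P : probability Omega R) (G : 'rV[int]_d -> Omega -> set 'rV[int]_d),
        half_orthant_model p P G -> shape_function P G gamma.

(* Main.v *)
(* Shifting [z] in [C_delta] by [- delta *: 1] lands in the cone [C], hence
   close to a rescaled reachable point [y]; since the error is at most
   [delta], [z - y] lies in the positive orthant.  Almost surely every site
   allows all the positive steps, so [z] is reachable from [y]. *)
Require Import Defs.
From mathcomp Require Import lra.

Lemma ler_norm_coord (R : realType) (d : nat) (v : 'rV[R]_d) (i : 'I_d) :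
  `|v ord0 i| <= `|v|.
Proof.
rewrite [leRHS]mx_normrE.
exact: (le_bigmax _ (fun ij : 'I_1 * 'I_d => `|v ij.1 ij.2|) (ord0, i)).
Qed.

(** Expand [y] in the canonical basis: each coordinate is a natural number [k], realised by [k]
    consecutive positive steps, so an induction on [k] is nested in one over the coordinates. *)
Lemma reachable_add_ge0 (d : nat) (g : 'rV[int]_d -> set 'rV[int]_d)
    (x y : 'rV[int]_d) :
  (forall z, @E_plus d `<=` g z) -> reachable g x ->
  (forall i, 0 <= y ord0 i) -> reachable g (x + y).
Proof.
move=> gE gx y0; rewrite [y]row_sum_delta.
elim: (index_enum 'I_d) => [|i s IHs]; first by rewrite big_nil addr0.
rewrite big_cons addrCA addrC.
move: (y ord0 i) (y0 i) => [k|//] _.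
elim: k => [|k IHk]; first by rewrite scale0r addr0.
rewrite intS scalerDl scale1r addrCA addrC.
by apply: reachable_step; [|apply: gE; exists i].
Qed.

(** Makes the events of [hom_plus] and [hom_full] disjoint. In dimension 0 both sets are empty. *)
Lemma E_plus_neq_E_full (d : nat) : (0 < d)%N -> @E_plus d <> @E_full d.
Proof.
move=> d0 eqE; pose i := Ordinal d0.
have : @E_plus d (- delta_mx 0 i) by rewrite eqE; right; exists i.
move=> [j _ /matrixP/(_ 0 i)]; rewrite !mxE !eqxx.
by case: (i == j).
Qed.

(** At one site the two disjoint events have total mass [p + (1 - p) = 1], and both values contain
    [E_plus]; there are countably many sites. *)
Lemma ae_E_plus_sub (R : realType) (d : nat) (p : R) (disp : measure_display)
    (Omega : measurableType disp) (P : probability Omega R)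
    (G : 'rV[int]_d -> Omega -> set 'rV[int]_d) :
  (0 < d)%N -> half_orthant_model p P G ->
  {ae P, forall w, forall x, @E_plus d `<=` G x w}.
Proof.
move=> d0 hG.
have ae_site x : {ae P, forall w, @E_plus d `<=` G x w}.
  pose B := [set @E_plus d] `|` [set @E_full d].
  have PB : P (G x @^-1` B) = 1%E.
    rewrite preimage_setU measureU; first last.
    - apply/seteqP; split=> // w [/= Gp Gf].
      by case: (E_plus_neq_E_full _ d0); rewrite -Gp -Gf.
    - exact: (hom_measurable hG).
    - exact: (hom_measurable hG).
    rewrite [X in (X + _)%E](hom_plus hG) [X in (_ + X)%E](hom_full hG).
    by rewrite -EFinD addrC subrK.
  have mB : measurable (G x @^-1` B) by exact: (hom_measurable hG).
  exists (~` (G x @^-1` B)); split; first exact: measurableC.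
    by rewrite probability_setC // PB subee.
  by apply: subsetC => w [] /= ->; [|exact: subsetUl].
(* Sites are enumerated through [unpickle]; codes of no site give a vacuous condition. *)
have /ae_foralln : forall n : nat, {ae P, forall w,
    forall x, unpickle n = Some x -> @E_plus d `<=` G x w}.
  move=> n; case: (unpickle n) => [x|]; last exact: nearW.
  by apply: filterS (ae_site x) => w Gw _ [<-].
by apply: filterS => w Gw x; apply: (Gw (pickle x)); exact: pickleK.
Qed.

Theorem corollary2 (R : realType) (d : nat) (hd : (2 <= d)%N)
    (p1 : R) (hp1 : shape_constant d p1)
    (p : R) (hp01 : 0 <= p <= 1) (hp : p1 < p)
    (disp : measure_display) (Omega : measurableType disp)
    (P : probability Omega R) (G : 'rV[int]_d -> Omega -> set 'rV[int]_d)
    (hG : half_orthant_model p P G)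
    (gamma : 'rV[R]_d -> R) (hgamma : shape_function P G gamma) :
  forall delta rho : R, 0 < delta ->
    {ae P, forall w : Omega, \forall n \near \oo,
      box rho `&` sublevel gamma (- delta)
          `&` rescale n [set: 'rV[int]_d]
        `<=` rescale n (reachable (G ^~ w))}.
Proof.
move=> delta rho delta0.
(* This radius bounds the norm of [z - delta *: const_mx 1]; the absolute value keeps it nonnegative
   when [rho < 0]. *)
have r0 : 0 <= `|rho| + delta * `|const_mx 1 : 'rV[R]_d|.
  by rewrite addr_ge0 ?mulr_ge0// ltW.
have aeE := ae_E_plus_sub _ _ _ _ _ _ _ (ltnW hd) hG.
have aeL := sf_lower hgamma delta0 r0.
apply: filterS (filterI aeE aeL) => w [GE sub_near].
apply: filterS (filterI (nbhs_infty_gt 0) sub_near) => n [n0 sub].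
move=> z [[zrho zdelta] [x _ xz]].
have n0' : 0 < n%:R^-1 :> R by rewrite invr_gt0 ltr0n.
have [] := sub (z - delta *: const_mx 1).
  split; last first.
    (* The shift rule takes only nonnegative scalars, so it is applied at the shifted point, going
       back up to [z]. *)
    have := shape_shift (sf_real hgamma) (ltW delta0 : [set r | 0 <= r] delta)
      (I : [set: 'rV[R]_d] (z - delta *: const_mx 1)).
    by rewrite subrK /sublevel/= => /eqP; move: zdelta; rewrite /sublevel/=; lra.
  rewrite /box/= (le_trans (ler_normB _ _))// mx_normZ gtr0_norm//.
  by rewrite lerD2r (le_trans zrho)// ler_norm.
move=> a abox [_ [y gy <-]] ayz.
exists x => //=.
rewrite -(subrKC y x); apply: reachable_add_ge0 => // i.
(* After scaling by [n%:R^-1], coordinate [i] of [x - y] equals [a ord0 i + delta], and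
   [a ord0 i >= - delta]. *)
rewrite !mxE -(ler0z R) rmorphB/= -(pmulr_rge0 _ n0').
have := ler_norm_coord _ _ a i.
move/le_trans => /(_ _ abox); rewrite ler_norml => /andP[al _].
move/rowP: ayz => /(_ i); move/rowP: xz => /(_ i); rewrite !mxE.
by lra.
Qed.
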